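(* Let $\{Y_{n1},Y_{n2},\ldots,Y_{nr_n}\}_{n\in\mathbb{N}}$ be a triangular array of row-wise independent nonnegative integer valued random variables such that $\min_{1\le k\le r_n}\mathbf P(Y_{nk}=0)\ge\frac34$ for all $n\in\mathbb{N}$. With $Y_n=\sum_{k=1}^{r_n}Y_{nk}$ and $\lambda_n=\sum_{k=1}^{r_n}\mathbf P(Y_{nk}\ge1)$, we have for every $n\in\mathbb{N}$ $$d_{\mathrm{TV}}(\mathcal D(Y_n),\mathrm{Po}(\lambda_n))\ge\frac1{10}\left(\prod_{k=1}^{r_n}\mathbf P(Y_{nk}=0)\right)\sum_{k=1}^{r_n}\left[\mathbf P(Y_{nk}\ge2)+\mathbf P(Y_{nk}\ge1)^2\right].$$
   Context: $\mathcal D(X)$ denotes the distribution of $X$; $\mathrm{Po}(\lambda)$ is the Poisson distribution with mean $\lambda$ ($\mathrm{Po}(0)$ being the point mass at $0$). For probability measures $\mu,\nu$ on $\mathbb{Z}_+=\{0,1,2,\ldots\}$, $d_{\mathrm{TV}}(\mu,\nu)=\sup_{A\subset\mathbb{Z}_+}|\mu(A)-\nu(A)|$. Row-wise independent means that for each $n$ the variables $Y_{n1},\ldots,Y_{nr_n}$ are independent. *)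

(* Defs.v *)
From HB Require Import structures.
From mathcomp Require Import all_boot all_order all_algebra.
From mathcomp Require Import all_classical all_reals all_analysis.
From mathcomp Require Import measurable_realfun.

Set Implicit Arguments.
Unset Strict Implicit.
Unset Printing Implicit Defensive.

Import Order.TTheory GRing.Theory Num.Theory.

Local Open Scope classical_set_scope.
Local Open Scope ring_scope.

(* [fine] loses nothing here, since a probability is finite on measurable
   sets. *)
Definition Pr d (T : measurableType d) (R : realType) (P : probability T R)
  (A : set T) : R := fine (P A).

(* Since each [B i] may be taken to be [setT], the product rule for the whole
   family contains the one for every subfamily. *)
Definition mutually_independent d d' (T : measurableType d)
    (T' : measurableType d') (R : realType) (P : probability T R)
    (I : finType) (X : I -> {RV P >-> T'}) : Prop :=
  forall B : I -> set T', (forall i, measurable (B i)) ->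
    Pr P [set w | forall i, B i (X i w)] = \prod_(i : I) Pr P (X i @^-1` B i).

Definition rv_sum d (T : measurableType d) (R : realType) (P : probability T R)
    (r : nat) (X : 'I_r -> {RV P >-> nat}) : T -> nat :=
  fun w => (\sum_(k < r) X k w)%N.

Lemma measurable_rv_sum d (T : measurableType d) (R : realType)
    (P : probability T R) (r : nat) (X : 'I_r -> {RV P >-> nat}) :
  measurable_fun setT (rv_sum X).
Proof.
rewrite /rv_sum; elim: r X => [|r IHr] X.
  by under eq_fun do rewrite big_ord0; exact: measurable_cst.
under eq_fun do rewrite big_ord_recr /=.
apply: measurable_fun_addn; last exact: measurable_funPT.
exact: (IHr (fun k => X (widen_ord (leqnSn r) k))).
Qed.

HB.instance Definition _ d (T : measurableType d) (R : realType)
    (P : probability T R) (r : nat) (X : 'I_r -> {RV P >-> nat}) :=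
  isMeasurableFun.Build _ _ T nat (rv_sum X) (measurable_rv_sum X).

(* The second argument of [poisson_prob] is not used by its definition; for
   [lambda = 0] the library's measure is the point mass at 0. *)
Definition Po (R : realType) (lambda : R) : probability nat R :=
  poisson_prob lambda 0%N.

(* Every subset of [nat] is measurable. *)
Definition dTV (R : realType) (mu nu : probability nat R) : R :=
  sup [set `|Pr mu A - Pr nu A| | A in [set: set nat]].

(* Hence the real-valued [sup] in [dTV] is a genuine supremum. *)
Lemma has_sup_dTV (R : realType) (mu nu : probability nat R) :
  has_sup [set `|Pr mu A - Pr nu A| | A in [set: set nat]].
Proof.
have Pr01 (m : probability nat R) (A : set nat) : 0 <= Pr m A <= 1.
  rewrite /Pr fine_ge0 ?measure_ge0//=.
  by rewrite -lee_fin fineK ?fin_num_measure// probability_le1.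
split; first by exists `|Pr mu set0 - Pr nu set0|, set0.
exists 1 => _ [A _ <-]; rewrite ler_norml.
have /andP[mu0 mu1] := Pr01 mu A; have /andP[nu0 nu1] := Pr01 nu A.
rewrite lerBlDr (le_trans mu1) ?lerDl// andbT lerBrDr.
by rewrite (le_trans _ mu0)// addrC subr_le0.
Qed.

(* Main.v *)
(** Test the total variation distance on [{0}] and on [{0, 1}].  Write
    [p_k = P(Y_k >= 1)], [q_k = P(Y_k >= 2)], [pi = P(Y = 0) = \prod (1 - p_k)]
    and [S = \sum p_k ^ 2].  Since [exp (- p) >= (1 - p / 2) ^ 2 >=
    (1 - p) (1 + p ^ 2 / 4)], the set [{0}] gives the bound [pi S / 4].  Since
    [p_k <= 1 / 4],
    [P(Y = 1) <= pi \sum (p_k - q_k) / (1 - p_k)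
              <= pi \sum (p_k + 4 / 3 p_k ^ 2 - q_k)],
    the set [{0, 1}] gives the bound [pi (\sum q_k - (4 / 3 - 1 / 4) S)].
    Weighting these bounds by 9/10 and 1/10 yields the result. *)

Require Import Defs.
From mathcomp Require Import all_boot all_order all_algebra.
From mathcomp Require Import all_classical all_reals all_analysis.
From mathcomp Require Import ring lra.

Import Order.TTheory GRing.Theory Num.Theory.

Local Open Scope classical_set_scope.
Local Open Scope ring_scope.

Section Pr_theory.
Context d (T : measurableType d) (R : realType) (P : probability T R).

Lemma Pr_ge0 (A : set T) : 0 <= Pr P A.
Proof. by rewrite /Pr fine_ge0. Qed.

Lemma Pr_setT : Pr P setT = 1.
Proof. by rewrite /Pr probability_setT. Qed.

Lemma PrU (A B : set T) : measurable A -> measurable B -> A `&` B = set0 ->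
  Pr P (A `|` B) = Pr P A + Pr P B.
Proof.
by move=> mA mB AB; rewrite /Pr measureU// fineD// fin_num_measure.
Qed.

Lemma Pr_subadditive n (A : set T) (B : nat -> set T) :
    measurable A -> (forall k, (k < n)%N -> measurable (B k)) ->
    A `<=` \big[setU/set0]_(k < n) B k ->
  Pr P A <= \sum_(k < n) Pr P (B k).
Proof.
move=> mA mB AB; rewrite -lee_fin -sumEFin /Pr fineK ?fin_num_measure//.
rewrite (eq_bigr (fun k : 'I_n => P (B k))) => [|k _].
  exact: content_subadditive.
by rewrite fineK// fin_num_measure//; exact: mB.
Qed.

End Pr_theory.

Section nat_valued.
Context {d} {T : measurableType d} {R : realType} (P : probability T R).
Variable X : {RV P >-> nat}.

Lemma measurable_RV_nat (B : set nat) : measurable (X @^-1` B).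
Proof. by rewrite -[_ @^-1` _]setTI; exact: measurable_funPT. Qed.

Lemma Pr_eq0 : Pr P [set w | X w = 0%N] = 1 - Pr P [set w | (1 <= X w)%N].
Proof.
apply/esym/eqP; rewrite subr_eq -(Pr_setT _ _ _ P) -PrU; first last.
- by apply/seteqP; split => w //= [->].
- exact: (measurable_RV_nat [set m | (1 <= m)%N]).
- exact: (measurable_RV_nat [set 0%N]).
apply/eqP; congr Pr; apply/seteqP; split => w //= _.
by case: (X w) => [|m]; [left|right].
Qed.

Lemma Pr_ge1 : Pr P [set w | (1 <= X w)%N] =
  Pr P [set w | X w = 1%N] + Pr P [set w | (2 <= X w)%N].
Proof.
rewrite -PrU; first last.
- by apply/seteqP; split => w //= [->].
- exact: (measurable_RV_nat [set m | (2 <= m)%N]).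
- exact: (measurable_RV_nat [set 1%N]).
congr Pr; apply/seteqP; split => w /=; last by case=> [->//|/ltnW].
by case: (X w) => [|[|m]]// _; [left|right].
Qed.

End nat_valued.

Section Poisson.
Context {R : realType}.

Lemma Pr_Po0 (lambda : R) : 0 <= lambda ->
  Pr (Po lambda) [set 0%N] = expR (- lambda).
Proof.
rewrite le_eqVlt => /predU1P[<-|l0]; rewrite /Pr /= /poisson_prob.
  by rewrite ltxx diracE mem_set// oppr0 expR0.
rewrite l0 esum_set1 ?lee_fin ?poisson_pmf_ge0//=.
by rewrite /poisson_pmf l0 expr0 fact0 divr1 mul1r.
Qed.

Lemma Pr_Po1 (lambda : R) : 0 <= lambda ->
  Pr (Po lambda) [set 1%N] = lambda * expR (- lambda).
Proof.
rewrite le_eqVlt => /predU1P[<-|l0]; rewrite /Pr /= /poisson_prob.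
  by rewrite ltxx diracE memNset// mul0r.
rewrite l0 esum_set1 ?lee_fin ?poisson_pmf_ge0//=.
by rewrite /poisson_pmf l0 expr1 divr1.
Qed.

(** Any test set bounds the distance from below. The sign is fixed so that [nu], the Poisson law in
    the application, carries the mass that is estimated from below. *)
Lemma dTV_ge (mu nu : probability nat R) (A : set nat) :
  Pr nu A - Pr mu A <= dTV mu nu.
Proof.
rewrite (le_trans (ler_norm _))// distrC.
by apply: sup_upper_bound; [exact: has_sup_dTV|exists A].
Qed.

End Poisson.

Section independent_sum.
Context {d} {T : measurableType d} {R : realType} {P : probability T R}.
Context {r : nat}.
Variable X : 'I_r -> {RV P >-> nat}.
Hypothesis X_indep : mutually_independent X.

Lemma Pr_rv_sum0 :
  Pr P (rv_sum X @^-1` [set 0%N]) = \prod_k Pr P [set w | X k w = 0%N].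
Proof.
rewrite -(X_indep (fun=> [set 0%N]))//; congr Pr.
apply/seteqP; split => w /=; rewrite /rv_sum.
  by move=> /eqP; rewrite sum_nat_eq0 => /forallP X0 i; apply/eqP/X0.
by move=> X0; rewrite big1.
Qed.

(** A sum equal to 1 has one index with value 1 while all others vanish. A union bound over that
    index is enough, since only an upper estimate is wanted. *)
Lemma Pr_rv_sum1_le :
  Pr P (rv_sum X @^-1` [set 1%N]) <=
  \sum_k Pr P [set w | X k w = 1%N] *
         \prod_(i | i != k) Pr P [set w | X i w = 0%N].
Proof.
(* The boolean is coerced to 0 or 1, so [B k] says that the vector of values is the [k]-th unit
   vector. *)
pose B (k : nat) := [set w | forall i : 'I_r, X i w = (i == k :> nat)].
have mB k : measurable (B k).
  rewrite (_ : B k = \big[setI/setT]_(i < r)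
      (X i @^-1` [set (i == k :> nat) : nat])).
    by apply: bigsetI_measurable => i _; exact: measurable_RV_nat.
  rewrite -bigcap_seq; apply/seteqP; split => w Xw i.
    by move=> _; exact: Xw.
  by apply: Xw; rewrite /= mem_index_enum.
apply: (le_trans (@Pr_subadditive _ _ _ _ r _ B _ (fun k _ => mB k) _)).
- exact: (measurable_RV_nat P (rv_sum X)).
- move=> w /= /eqP /sum_nat_eq1[k [_ Xk1 Xk0]].
  rewrite -bigcup_mkord; exists k => //= i.
  by case: eqVneq => [/val_inj ->//|ik]; apply: Xk0.
- apply: ler_sum => k _.
  rewrite (X_indep (fun i => [set (i == k :> nat) : nat]))// (bigD1 k)//= eqxx.
  rewrite (eq_bigr (fun i => Pr P [set w | X i w = 0%N]))// => i /negbTE ik.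
  by rewrite (_ : (i == k :> nat) = false).
Qed.

End independent_sum.

Lemma expRN_ge_quadratic {R : realType} (p : R) : 0 <= p <= 1 ->
  (1 - p) * (1 + p ^+ 2 / 4) <= expR (- p).
Proof.
move=> /andP[p0 p1].
have -> : - p = - (p / 2) + - (p / 2) by lra.
have := expR_ge1Dx (- (p / 2)); rewrite expRD.
set e := expR _ => he.
have e0 : 0 <= e by exact: expR_ge0.
have : (1 - p / 2) * (1 - p / 2) <= e * e by apply: ler_pM; lra.
(* [(1 - p / 2) ^ 2] exceeds the left-hand side by exactly [p ^ 3 / 4]. *)
have : 0 <= p ^+ 3 by exact: exprn_ge0.
by nra.
Qed.

(** Weierstrass product inequality: the higher-order terms of the expanded product are
    nonnegative. *)
Lemma prod_1D_ge {R : realDomainType} (I : Type) (s : seq I) (x : I -> R) :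
  (forall i, 0 <= x i) -> 1 + \sum_(i <- s) x i <= \prod_(i <- s) (1 + x i).
Proof.
move=> x0; elim: s => [|i s IHs]; first by rewrite !big_nil addr0.
rewrite !big_cons.
have : 0 <= \sum_(j <- s) x j by apply: sumr_ge0 => k _; exact: x0.
have := x0 i; move: IHs; nra.
Qed.

Lemma dTV_rv_sum_ge d (T : measurableType d) (R : realType)
    (P : probability T R) (r : nat) (X : 'I_r -> {RV P >-> nat}) :
    mutually_independent X ->
    (forall k, 3 / 4 <= Pr P [set w | X k w = 0%N]) ->
  1 / 10 * (\prod_(k < r) Pr P [set w | X k w = 0%N]) *
    (\sum_(k < r) (Pr P [set w | (2 <= X k w)%N] +
                   Pr P [set w | (1 <= X k w)%N] ^+ 2))
  <= dTV (distribution P (rv_sum X))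
         (Po (\sum_(k < r) Pr P [set w | (1 <= X k w)%N])).
Proof.
move=> X_indep X0.
pose p k := Pr P [set w | (1 <= X k w)%N].
pose q k := Pr P [set w | (2 <= X k w)%N].
set pi := \prod_(k < r) _.
set lambda := \sum_(k < r) Pr P [set w | (1 <= X k w)%N].
have p0 k : 0 <= p k by exact: Pr_ge0.
have q0 k : 0 <= q k by exact: Pr_ge0.
have p4 k : p k <= 1 / 4 by have := X0 k; rewrite Pr_eq0 -/(p k); lra.
have lambda0 : 0 <= lambda by apply: sumr_ge0 => k _; exact: p0.
have pi_ge0 : 0 <= pi by apply: prodr_ge0 => k _; exact: Pr_ge0.
pose S := \sum_(k < r) p k ^+ 2; pose Q := \sum_(k < r) q k.
rewrite big_split /= -/S -/Q.
(* Factor by factor, [expR (- p k)] dominates [(1 - p k) * (1 + p k ^+ 2 / 4)]; the second factors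
   are then collected into [1 + S / 4]. *)
have piS : pi * (1 + S / 4) <= expR (- lambda).
  rewrite -sumrN expR_sum /S mulr_suml.
  apply: (@le_trans _ _ (pi * \prod_(k < r) (1 + p k ^+ 2 / 4))).
    by rewrite ler_wpM2l// prod_1D_ge// => k; rewrite divr_ge0// sqr_ge0.
  rewrite /pi -big_split/=; apply: ler_prod => k _; rewrite Pr_eq0 -/(p k).
  rewrite expRN_ge_quadratic ?andbT; last by have := p0 k; have := p4 k; lra.
  by have := p0 k; have := p4 k; have := sqr_ge0 (p k); nra.
have Y1 : Pr P (rv_sum X @^-1` [set 1%N]) <= pi * (lambda + 4 / 3 * S - Q).
  apply: (le_trans (Pr_rv_sum1_le _ X_indep)).
  have -> : lambda + 4 / 3 * S - Q =
      \sum_(k < r) (p k + 4 / 3 * p k ^+ 2 - q k).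
    by rewrite sumrB big_split/= -mulr_sumr.
  rewrite mulr_sumr; apply: ler_sum => k _.
  have -> : pi = Pr P [set w | X k w = 0%N] *
      \prod_(i | i != k) Pr P [set w | X i w = 0%N] by rewrite /pi (bigD1 k).
  rewrite mulrAC ler_wpM2r//.
    by apply: prodr_ge0 => i _; exact: Pr_ge0.
  have := Pr_ge1 P (X k); rewrite Pr_eq0 -/(p k) -/(q k).
  set s := Pr P _ => ps.
  have -> : s = p k - q k by rewrite ps addrK.
  (* With [p], [q] for [p k], [q k], the right side minus the left is
     [p ^ 2 * (1 - 4 * p) / 3 + p * q], nonnegative because [p <= 1 / 4]; this is where 4/3 comes
     from. *)
  have := p0 k; have := p4 k; have := q0 k; have := sqr_ge0 (p k).
  by nra.
have dTV0 := dTV_ge (distribution P (rv_sum X)) (Po lambda) [set 0%N].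
have dTV01 := dTV_ge (distribution P (rv_sum X)) (Po lambda)
  ([set 0%N] `|` [set 1%N]).
have disj : [set 0%N] `&` [set 1%N] = set0 by apply/seteqP; split=> m //= [->].
rewrite !PrU// Pr_Po0// Pr_Po1// in dTV0 dTV01.
rewrite -[Pr (distribution _ _) [set 0%N]]
  /(Pr P (rv_sum X @^-1` [set 0%N])) in dTV0 dTV01.
rewrite -[Pr (distribution _ _) [set 1%N]]
  /(Pr P (rv_sum X @^-1` [set 1%N])) in dTV01.
rewrite (Pr_rv_sum0 _ X_indep) -/pi in dTV0 dTV01.
have piS0 : 0 <= pi * S.
  by rewrite mulr_ge0//; apply: sumr_ge0 => k _; exact: sqr_ge0.
(* Lets [lambda * expR (- lambda)], the Poisson mass at 1, absorb the term [pi * lambda] of [Y1]. *)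
have : 0 <= lambda * (expR (- lambda) - pi).
  rewrite mulr_ge0// subr_ge0; apply: le_trans piS.
  by rewrite ler_peMr// lerDl divr_ge0// sumr_ge0// => k _; exact: sqr_ge0.
(* With weights 9/10 and 1/10 the coefficient of [pi * S] is 9/40 - 13/120 = 7/60, which exceeds the
   required 1/10; that of [pi * Q] is exactly 1/10. *)
move: (expR _) (Pr P _) (dTV _ _) Y1 piS dTV0 dTV01 piS0 => e y D; lra.
Qed.

Theorem theorem5p1p3 (R : realType)
    (d : nat -> measure_display) (T : forall n : nat, measurableType (d n))
    (P : forall n : nat, probability (T n) R)
    (r : nat -> nat)
    (Y : forall n : nat, 'I_(r n) -> {RV (P n) >-> nat})
    (Y_indep : forall n : nat, mutually_independent (Y n))
    (Y_eq0 : forall (n : nat) (k : 'I_(r n)),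
      3 / 4 <= Pr (P n) [set w | Y n k w = 0%N]) :
  let lambda (n : nat) : R :=
    \sum_(k < r n) Pr (P n) [set w | (1 <= Y n k w)%N] in
  forall n : nat,
    1 / 10 * (\prod_(k < r n) Pr (P n) [set w | Y n k w = 0%N]) *
      (\sum_(k < r n) (Pr (P n) [set w | (2 <= Y n k w)%N] +
                       Pr (P n) [set w | (1 <= Y n k w)%N] ^+ 2))
    <= dTV (distribution (P n) (rv_sum (Y n))) (Po (lambda n)).
Proof. by move=> lambda n; exact: dTV_rv_sum_ge. Qed.
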